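(* Let $\mathcal{C}$ be either $\mathcal{C}_{HS}$ or $\mathcal{C}_P$. Let $H$ be a finite group, let $G$ be a finitely generated $\mathcal{C}$-stable group and let $i\colon H\to G$ be an injective homomorphism. Then the HNN extension $G*_{i,i}$ is $\mathcal{C}$-stable.
   Context: $\mathcal{C}_{HS}$ is the class of groups $\mathrm{Aut}(X)$, where $X$ is a finite-dimensional Hilbert space and $\mathrm{Aut}(X)$ is its unitary group, with the metric $d(A_1,A_2)=\|A_1-A_2\|_{HS}$, $\|A\|_{HS}=\mathrm{Tr}(A^*A)^{1/2}$, $\mathrm{Tr}$ the normalized trace. $\mathcal{C}_P$ is the class of groups $\mathrm{Aut}(X)$, where $X$ is a finite set and $\mathrm{Aut}(X)$ is its symmetric group, with the normalized Hamming metric $d(\sigma_1,\sigma_2)=\frac{1}{|X|}\#\{x\in X:\sigma_1(x)\neq\sigma_2(x)\}$. A group $G$ is $\mathcal{C}$-stable if for any sequence of maps $\varphi_n\colon G\to\mathrm{Aut}(X_n)\in\mathcal{C}$ with $d(\varphi_n(g)\varphi_n(h),\varphi_n(gh))\to0$ as $n\to\infty$ for all $g,h\in G$, there is a sequence of homomorphisms $\psi_n\colon G\to\mathrm{Aut}(X_n)$ with $d(\varphi_n(g),\psi_n(g))\to0$ for all $g\in G$. The HNN extension of $G$ relative to injective homomorphisms $i_1,i_2\colon H\to G$ is $G*_{i_1,i_2}:=(G*\mathbb{Z})/\langle\langle i_1(h)^{-1}\,t\,i_2(h)\,t^{-1}: h\in H\rangle\rangle$, where $\mathbb{Z}=\langle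 t\rangle$; here $i_1=i_2=i$. *)

(* Defs.v *)
From HB Require Import structures.
From mathcomp Require Import all_boot all_order all_fingroup all_algebra.
From mathcomp Require Import generic_quotient spectral sesquilinear complex.
From mathcomp Require Import all_classical all_reals all_analysis.

Set Implicit Arguments.
Unset Strict Implicit.
Unset Printing Implicit Defensive.

Import Order.TTheory GRing.Theory Num.Theory.
Import numFieldNormedType.Exports.

Local Open Scope classical_set_scope.
Local Open Scope group_scope.

Section Subgroups.
Variable G : groupType.
Implicit Types (N S : set G) (x y : G).

Definition subgroup N : Prop :=
  [/\ N 1, forall x y, N x -> N y -> N (x * y) & forall x, N x -> N x^-1].

Definition normal_subgroup N : Prop :=
  subgroup N /\ forall x y, N x -> N (x ^ y).

Definition finitely_generated : Prop :=
  exists s : seq G, smallest subgroup [set` s] = setT.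

Definition normal_closure S : set G := smallest normal_subgroup S.

Lemma normal_closureP S : normal_subgroup (normal_closure S).
Proof.
split; first split.
- by move=> N [[[N1 _ _] _] _].
- move=> x y Sx Sy N NS; have [[[_ NM _] _] _] := NS.
  by apply: NM; [apply: Sx | apply: Sy].
- by move=> x Sx N NS; have [[[_ _ NV] _] _] := NS; apply: NV; apply: Sx.
- by move=> x y Sx N NS; have [[_ NJ] _] := NS; apply: NJ; apply: Sx.
Qed.

End Subgroups.

(* The quotient of G by the normal closure of a set S of relators. *)
Section Quotient.
Variables (G : groupType) (S : set G).
Implicit Types x y z : G.

Definition quot_rel : rel G := fun x y => `[< normal_closure S (x^-1 * y) >].

Fact quot_rel_refl : reflexive quot_rel.
Proof. by move=> x; apply/asboolP; rewrite mulVg; case: (normal_closureP S) => -[]. Qed.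

Fact quot_rel_sym : symmetric quot_rel.
Proof.
have [[_ _ NV] _] := normal_closureP S.
by move=> x y; apply/asboolP/asboolP => /NV; rewrite invgM invgK.
Qed.

Fact quot_rel_trans : transitive quot_rel.
Proof.
have [[_ NM _] _] := normal_closureP S.
move=> y x z /asboolP xy /asboolP yz; apply/asboolP.
by have := NM _ _ xy yz; rewrite mulgA -(mulgA x^-1) mulgV mulg1.
Qed.

Canonical quot_equiv :=
  EquivRel quot_rel quot_rel_refl quot_rel_sym quot_rel_trans.

Definition quot_group := {eq_quot quot_equiv}%qT.
HB.instance Definition _ := Choice.on quot_group.
HB.instance Definition _ := EqQuotient.on quot_group.

Local Open Scope quotient_scope.
Local Notation pi := (\pi_quot_group).

Definition quot_one : quot_group := pi 1.
Definition quot_mul (a b : quot_group) : quot_group := pi (repr a * repr b).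
Definition quot_inv (a : quot_group) : quot_group := pi (repr a)^-1.

Fact quot_piP x y : pi x = pi y <-> normal_closure S (x^-1 * y).
Proof.
split=> [e | N]; first by apply/asboolP/(@eqmodP _ quot_equiv x y).
by apply/(@eqmodP _ quot_equiv x y)/asboolP.
Qed.

Fact quot_piM x y : quot_mul (pi x) (pi y) = pi (x * y).
Proof.
have [[_ NM _] NJ] := normal_closureP S.
have /quot_piP Nx : pi (repr (pi x)) = pi x by rewrite reprK.
have /quot_piP Ny : pi (repr (pi y)) = pi y by rewrite reprK.
apply/quot_piP; set x' := repr _ in Nx *; set y' := repr _ in Ny *.
have := NM _ _ (NJ _ y' Nx) Ny.
by rewrite /conjg invgM !mulgA mulgK.
Qed.

Fact quot_piV x : quot_inv (pi x) = pi x^-1.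
Proof.
have [[_ _ NV] NJ] := normal_closureP S.
have /quot_piP Nx : pi (repr (pi x)) = pi x by rewrite reprK.
apply/quot_piP; set x' := repr _ in Nx *.
have := NJ _ x'^-1 (NV _ Nx).
by rewrite /conjg invgM !invgK !mulgA mulgK.
Qed.

Fact quot_mulA : associative quot_mul.
Proof.
move=> a b c; rewrite -[a]reprK -[b]reprK -[c]reprK.
rewrite (quot_piM (repr b) (repr c)) (quot_piM (repr a) (repr b)).
by rewrite (quot_piM (repr a * repr b) (repr c)) (quot_piM (repr a) (repr b * repr c)) mulgA.
Qed.

Fact quot_mul1g : left_id quot_one quot_mul.
Proof. by move=> a; rewrite -[a]reprK quot_piM mul1g. Qed.

Fact quot_mulVg : left_inverse quot_one quot_inv quot_mul.
Proof. by move=> a; rewrite -[a]reprK quot_piV quot_piM mulVg. Qed.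

Fact quot_mulg1 : right_id quot_one quot_mul.
Proof. by move=> a; rewrite -[a]reprK quot_piM mulg1. Qed.

Fact quot_mulgV : right_inverse quot_one quot_inv quot_mul.
Proof. by move=> a; rewrite -[a]reprK quot_piV quot_piM mulgV. Qed.

HB.instance Definition _ := isGroup.Build quot_group
  quot_mulA quot_mul1g quot_mulg1 quot_mulVg quot_mulgV.

End Quotient.

(* The free product A * B: words with letters in A and B, modulo the congruence
   that multiplies adjacent letters of the same factor and erases identities. *)
Section FreeProduct.
Variables A B : groupType.
Implicit Types (a : A) (b : B) (u v w : seq (A + B)).

Inductive fprod_eq : seq (A + B) -> seq (A + B) -> Prop :=
| fprod_mull u v a a' :
    fprod_eq (u ++ [:: inl a; inl a'] ++ v) (u ++ [:: inl (a * a')] ++ v)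
| fprod_mulr u v b b' :
    fprod_eq (u ++ [:: inr b; inr b'] ++ v) (u ++ [:: inr (b * b')] ++ v)
| fprod_onel u v : fprod_eq (u ++ [:: inl 1] ++ v) (u ++ v)
| fprod_oner u v : fprod_eq (u ++ [:: inr 1] ++ v) (u ++ v)
| fprod_refl w : fprod_eq w w
| fprod_sym u v : fprod_eq u v -> fprod_eq v u
| fprod_trans u v w : fprod_eq u v -> fprod_eq v w -> fprod_eq u w.

Definition fprod_rel : rel (seq (A + B)) := fun u v => `[< fprod_eq u v >].

Fact fprod_rel_refl : reflexive fprod_rel.
Proof. by move=> w; apply/asboolP/fprod_refl. Qed.

Fact fprod_rel_sym : symmetric fprod_rel.
Proof. by move=> u v; apply/asboolP/asboolP; apply: fprod_sym. Qed.

Fact fprod_rel_trans : transitive fprod_rel.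
Proof.
by move=> v u w /asboolP uv /asboolP vw; apply/asboolP/(fprod_trans uv vw).
Qed.

Canonical fprod_equiv :=
  EquivRel fprod_rel fprod_rel_refl fprod_rel_sym fprod_rel_trans.

Definition free_prod := {eq_quot fprod_equiv}%qT.
HB.instance Definition _ := Choice.on free_prod.
HB.instance Definition _ := EqQuotient.on free_prod.

Local Open Scope quotient_scope.
Local Notation pi := (\pi_free_prod).

Definition letterV (l : A + B) : A + B :=
  match l with inl a => inl a^-1 | inr b => inr b^-1 end.
Definition wordV w := rev (map letterV w).

Definition fprod_one : free_prod := pi [::].
Definition fprod_mul (x y : free_prod) : free_prod := pi (repr x ++ repr y).
Definition fprod_inv (x : free_prod) : free_prod := pi (wordV (repr x)).

Fact fprod_piP u v : pi u = pi v <-> fprod_eq u v.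
Proof.
split=> [e | N]; first by apply/asboolP/(@eqmodP _ fprod_equiv u v).
by apply/(@eqmodP _ fprod_equiv u v)/asboolP.
Qed.

Fact fprod_eq_cat2 u v w w' :
  fprod_eq u v -> fprod_eq (w ++ u ++ w') (w ++ v ++ w').
Proof.
elim=> {u v} [u v a a'|u v b b'|u v|u v|u|u v _|u v x _ uv _].
- by have := fprod_mull (w ++ u) (v ++ w') a a'; rewrite -!catA.
- by have := fprod_mulr (w ++ u) (v ++ w') b b'; rewrite -!catA.
- by have := fprod_onel (w ++ u) (v ++ w'); rewrite -!catA.
- by have := fprod_oner (w ++ u) (v ++ w'); rewrite -!catA.
- exact: fprod_refl.
- exact: fprod_sym.
- exact: fprod_trans.
Qed.

Fact fprod_eqV u v : fprod_eq u v -> fprod_eq (wordV u) (wordV v).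
Proof.
rewrite /wordV; elim=> {u v} [u v a a'|u v b b'|u v|u v|u|u v _|u v w _ uv _].
- have := fprod_mull (wordV v) (wordV u) a'^-1 a^-1.
  by rewrite /wordV !map_cat !rev_cat -!catA -invgM.
- have := fprod_mulr (wordV v) (wordV u) b'^-1 b^-1.
  by rewrite /wordV !map_cat !rev_cat -!catA -invgM.
- have := fprod_onel (wordV v) (wordV u).
  by rewrite /wordV !map_cat !rev_cat -!catA /= invg1.
- have := fprod_oner (wordV v) (wordV u).
  by rewrite /wordV !map_cat !rev_cat -!catA /= invg1.
- exact: fprod_refl.
- exact: fprod_sym.
- exact: fprod_trans.
Qed.

Fact fprod_piM u v : fprod_mul (pi u) (pi v) = pi (u ++ v).
Proof.
have /fprod_piP eu : pi (repr (pi u)) = pi u by rewrite reprK.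
have /fprod_piP ev : pi (repr (pi v)) = pi v by rewrite reprK.
apply/fprod_piP; apply: fprod_trans (fprod_eq_cat2 [::] _ eu) _.
by have := fprod_eq_cat2 u [::] ev; rewrite !cats0.
Qed.

Fact fprod_piV u : fprod_inv (pi u) = pi (wordV u).
Proof.
have /fprod_piP eu : pi (repr (pi u)) = pi u by rewrite reprK.
exact/fprod_piP/fprod_eqV.
Qed.

Fact fprod_mulA : associative fprod_mul.
Proof.
move=> x y z; rewrite -[x]reprK -[y]reprK -[z]reprK.
rewrite (fprod_piM (repr y) (repr z)) (fprod_piM (repr x) (repr y)).
by rewrite (fprod_piM (repr x ++ repr y) (repr z)) (fprod_piM (repr x) (repr y ++ repr z)) catA.
Qed.

Fact fprod_mul1g : left_id fprod_one fprod_mul.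
Proof. by move=> x; rewrite -[x]reprK fprod_piM. Qed.

Fact fprod_mulg1 : right_id fprod_one fprod_mul.
Proof. by move=> x; rewrite -[x]reprK fprod_piM cats0. Qed.

Fact wordVK : involutive wordV.
Proof.
move=> w; rewrite /wordV map_rev revK -map_comp -[RHS]map_id.
by apply: eq_map => -[a|b] /=; rewrite invgK.
Qed.

Fact fprod_mulVg : left_inverse fprod_one fprod_inv fprod_mul.
Proof.
move=> x; rewrite -[x]reprK fprod_piV fprod_piM; apply/fprod_piP.
elim: (repr x) => [|l w IHw]; first exact: fprod_refl.
apply: fprod_trans IHw; rewrite /wordV /= rev_cons -cats1 -catA.
case: l => [a|b] /=.
- apply: fprod_trans (fprod_mull _ _ _ _) _; rewrite mulVg.
  exact: fprod_onel.
- apply: fprod_trans (fprod_mulr _ _ _ _) _; rewrite mulVg.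
  exact: fprod_oner.
Qed.

Fact fprod_mulgV : right_inverse fprod_one fprod_inv fprod_mul.
Proof.
have invK : involutive fprod_inv.
  by move=> x; rewrite -[x]reprK (fprod_piV (repr x)) fprod_piV wordVK.
by move=> x; rewrite -{1}[x]invK fprod_mulVg.
Qed.

HB.instance Definition _ := isGroup.Build free_prod
  fprod_mulA fprod_mul1g fprod_mulg1 fprod_mulVg fprod_mulgV.

Definition fprod_inl a : free_prod := pi [:: inl a].
Definition fprod_inr b : free_prod := pi [:: inr b].

End FreeProduct.

(* The additive group of int, written multiplicatively; its generator is 1 in
   int, whereas the identity element of the group is 0 in int. *)
Definition Zcyc := int.
HB.instance Definition _ := Choice.on Zcyc.
HB.instance Definition _ := isGroup.Build Zcyc
  (@addrA int) (@add0r int) (@addr0 int) (@addNr int) (@addrN int).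
Definition Zcyc_gen : Zcyc := 1%R : int.

Section HNN.
Variables (G H : groupType) (i1 i2 : H -> G).

Definition stable_letter : free_prod G Zcyc := fprod_inr G Zcyc_gen.

Definition hnn_relators : set (free_prod G Zcyc) :=
  [set (fprod_inl Zcyc (i1 h))^-1 * stable_letter
       * fprod_inl Zcyc (i2 h) * stable_letter^-1 | h in [set: H]].

Definition HNN : groupType := quot_group hnn_relators.

End HNN.

Section Unitary.
Variables (C : numClosedFieldType) (n : nat).

Record unitary : predArgType :=
  Unitary { unitary_mx :> 'M[C]_n ; unitary_mxP : unitary_mx \is unitarymx }.

HB.instance Definition _ := [isSub for unitary_mx].
HB.instance Definition _ := [Choice of unitary by <:].

Local Open Scope sesquilinear_scope.

Fact unitary1_subproof : (1%:M : 'M[C]_n)%R \is unitarymx.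
Proof. by apply/unitarymxP; rewrite trmx1 map_mx1 mulmx1. Qed.

Fact unitaryV_subproof (A : unitary) : ((A : 'M[C]_n)^t* )%R \is unitarymx.
Proof. by rewrite trmxC_unitary unitary_mxP. Qed.

Definition unitary_one : unitary := Unitary unitary1_subproof.
Definition unitary_mul (A B : unitary) : unitary :=
  Unitary (mul_unitarymx (unitary_mxP A) (unitary_mxP B)).
Definition unitary_inv (A : unitary) : unitary :=
  Unitary (unitaryV_subproof A).

Fact unitary_mulA : associative unitary_mul.
Proof. by move=> A B D; apply/val_inj/mulmxA. Qed.

Fact unitary_mul1g : left_id unitary_one unitary_mul.
Proof. by move=> A; apply/val_inj/mul1mx. Qed.

Fact unitary_mulg1 : right_id unitary_one unitary_mul.
Proof. by move=> A; apply/val_inj/mulmx1. Qed.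

Fact unitary_mulgV : right_inverse unitary_one unitary_inv unitary_mul.
Proof. by move=> A; apply/val_inj/unitarymxP/unitary_mxP. Qed.

Fact unitary_mulVg : left_inverse unitary_one unitary_inv unitary_mul.
Proof. by move=> A; apply/val_inj/mulmx1C/unitarymxP/unitary_mxP. Qed.

HB.instance Definition _ := isGroup.Build unitary
  unitary_mulA unitary_mul1g unitary_mulg1 unitary_mulVg unitary_mulgV.

End Unitary.

Section Metrics.
Variable R : realType.
Local Open Scope ring_scope.
Local Open Scope sesquilinear_scope.

(* The trace of A^* A is a nonnegative real, so Re only changes its type. *)
Definition HS_norm (n : nat) (A : 'M[R[i]]_n) : R :=
  Num.sqrt (complex.Re (\tr (A^t* *m A) / n%:R)).

Definition HS_dist (n : nat) (A1 A2 : unitary R[i] n) : R :=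
  HS_norm (unitary_mx A1 - unitary_mx A2).

Definition hamming_dist (X : finType) (s1 s2 : {perm X}) : R :=
  #|[pred x | s1 x != s2 x]|%:R / #|X|%:R.

End Metrics.

(* A class of groups Aut(X), X ranging over some objects, with metrics. *)
Record metric_class (R : realType) := MetricClass {
  mc_obj : Type;
  mc_aut : mc_obj -> groupType;
  mc_dist : forall X : mc_obj, mc_aut X -> mc_aut X -> R
}.

(* Up to isometry, the finite-dimensional Hilbert spaces are the C^n. Over C^0
   and over the empty set the group is trivial and its distance is 0 / 0 = 0. *)
Definition C_HS (R : realType) : metric_class R :=
  {| mc_obj := nat; mc_aut := fun n => unitary R[i] n; mc_dist := @HS_dist R |}.

(* The product of permutations is (s * t) x = t (s x); inversion is an isometric
   isomorphism onto the group with the opposite convention. *)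
Definition C_P (R : realType) : metric_class R :=
  {| mc_obj := finType; mc_aut := fun X => {perm X}; mc_dist := @hamming_dist R |}.

Definition stable (R : realType) (C : metric_class R) (G : groupType) : Prop :=
  forall (X : nat -> mc_obj C) (phi : forall n, G -> mc_aut (X n)),
    (forall g h : G,
       mc_dist (phi n g * phi n h) (phi n (g * h)) @[n --> \oo] --> (0%R : R)) ->
  exists psi : forall n, {multiplicative G -> mc_aut (X n)},
    forall g : G, mc_dist (phi n g) (psi n g) @[n --> \oo] --> (0%R : R).

(* Main.v *)
(* HNN(i, i) is presented by G, a letter t and the relations [t, i(h)] = 1, h in
   H. Given an asymptotic homomorphism phi_n of it, stability of G replaces phi_n
   on G by homomorphisms psi_n; then phi_n(t) almost commutes with the finite
   group psi_n(i(H)), and it remains to move phi_n(t) by o(1) to an element u_n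
   of the centralizer of that group: psi_n and t |-> u_n define the required
   homomorphisms.

   For a unitary T and a unitary representation rho of H, average
   rho(h) T rho(h)^-1 over H, add a small scalar to get an invertible A in the
   commutant, and take its unitary polar part U. It lies in the commutant and is
   a unitary nearest to A, so |T - U| <= 2 |T - A|.

   For a permutation s, the points x at which s commutes with all of H
   form an H-invariant set whose complement N is small. Composing s with the
   first return map of s^-1 to N makes it equivariant, and changes it on N only. *)

From HB Require Import structures.
Require Import Defs.
From mathcomp Require Import all_boot all_order all_fingroup all_algebra.
From mathcomp Require Import generic_quotient spectral sesquilinear complex.
From mathcomp Require Import all_classical all_reals all_analysis.
From mathcomp Require Import ring lra.

Set Implicit Arguments.
Unset Strict Implicit.
Unset Printing Implicit Defensive.

Import Order.TTheory GRing.Theory Num.Theory.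
Import numFieldNormedType.Exports.

Local Open Scope classical_set_scope.
Local Open Scope group_scope.

(** * Morphisms out of HNN extensions *)

Lemma multiplicative1 (G K : groupType) (f : {multiplicative G -> K}) : f 1 = 1.
Proof. by apply: (mulgI (f 1)); rewrite -gmulfM !mulg1. Qed.

Lemma multiplicativeV (G K : groupType) (f : {multiplicative G -> K}) x :
  f x^-1 = (f x)^-1.
Proof. by apply: (mulgI (f x)); rewrite -gmulfM !mulgV multiplicative1. Qed.

Section IntPower.
Variables (K : groupType) (t : K).

Definition expgz (z : Zcyc) : K :=
  match z with Posz n => t ^+ n | Negz n => t ^- n.+1 end.

Lemma expgzS (z : int) : expgz (z + 1)%R = expgz z * t.
Proof.
case: z => [n|[|n]]; first by rewrite addrC -intS /= expgSr.
  by rewrite /= expg1 mulVg.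
rewrite (_ : (Negz n.+1 + 1)%R = Negz n); last first.
  by rewrite !NegzE intS opprD addrAC subrr sub0r.
by rewrite /= [t ^+ n.+2]expgS invgM mulgKV.
Qed.

Lemma expgzP (z : int) : expgz (z - 1)%R = expgz z * t^-1.
Proof. by rewrite -[z in RHS](subrK 1%R) expgzS mulgK. Qed.

Lemma expgzM (x y : Zcyc) : expgz (x * y) = expgz x * expgz y.
Proof.
have E (a b : int) : expgz (a + b)%R = expgz a * expgz b.
  elim/int_rec: b => [|n IHn|n IHn]; first by rewrite addr0 mulg1.
    by rewrite intS [X in (a + X)%R]addrC [X in _ * expgz X]addrC
      addrA !expgzS IHn mulgA.
  by rewrite intS opprD [X in (a + X)%R]addrC [X in _ * expgz X]addrC
    addrA !expgzP IHn mulgA.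
exact: E.
Qed.

HB.instance Definition _ := isMultiplicative.Build Zcyc K expgz expgzM.

End IntPower.

Lemma multiplicative_expgz (K : groupType) (f : {multiplicative Zcyc -> K}) z :
  f z = expgz (f Zcyc_gen) z.
Proof.
have fX n : f (Posz n : Zcyc) = f Zcyc_gen ^+ n.
  elim: n => [|n IHn]; first exact: multiplicative1.
  by rewrite expgS -IHn -gmulfM; congr (f _); exact: intS.
by case: z => n; rewrite /= -fX // -multiplicativeV.
Qed.

Section FreeProductLift.
Variables (A B K : groupType).
Variables (f : {multiplicative A -> K}) (g : {multiplicative B -> K}).

Definition letter_eval (l : A + B) : K :=
  match l with inl a => f a | inr b => g b end.

Definition word_eval (w : seq (A + B)) : K := \prod_(l <- w) letter_eval l.

Lemma word_eval_cat u v : word_eval (u ++ v) = word_eval u * word_eval v.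
Proof. exact: big_cat. Qed.

(** Each rule generating [fprod_eq] is respected because [f] and [g] are morphisms. This makes
    evaluation of a chosen representative well defined. *)
Lemma word_eval_eq u v : fprod_eq u v -> word_eval u = word_eval v.
Proof.
elim=> {u v} [u v a a'|u v b b'|u v|u v|//|u v _ -> //|u v w _ -> _ -> //].
by rewrite !word_eval_cat /word_eval !big_cons big_nil /= !mulg1 gmulfM.
- by rewrite !word_eval_cat /word_eval !big_cons big_nil /= !mulg1 gmulfM.
- by rewrite !word_eval_cat {2}/word_eval big_seq1 /= multiplicative1 mul1g.
- by rewrite !word_eval_cat {2}/word_eval big_seq1 /= multiplicative1 mul1g.
Qed.

Definition fprod_lift (x : free_prod A B) : K := word_eval (repr x).

Lemma fprod_lift_pi w : fprod_lift (\pi_(free_prod A B) w)%qT = word_eval w.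
Proof. by apply/word_eval_eq/fprod_piP; rewrite reprK. Qed.

Fact fprod_liftM : {morph fprod_lift : x y / x * y}.
Proof.
move=> x y; rewrite -[x]reprK -[y]reprK [X in fprod_lift X]fprod_piM.
by rewrite !fprod_lift_pi word_eval_cat.
Qed.

HB.instance Definition _ := isMultiplicative.Build _ _ fprod_lift fprod_liftM.

Lemma fprod_lift_inl a : fprod_lift (fprod_inl B a) = f a.
Proof. by rewrite fprod_lift_pi /word_eval big_seq1. Qed.

Lemma fprod_lift_inr b : fprod_lift (fprod_inr A b) = g b.
Proof. by rewrite fprod_lift_pi /word_eval big_seq1. Qed.

End FreeProductLift.

Lemma fprod_ind (A B : groupType) (P : free_prod A B -> Prop) :
  P 1 -> (forall x y, P x -> P y -> P (x * y)) ->
  (forall a, P (fprod_inl B a)) -> (forall b, P (fprod_inr A b)) ->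
  forall x, P x.
Proof.
move=> P1 PM Pl Pr x; rewrite -[x]reprK.
elim: (repr x) => [//|l w IHw]; rewrite -cat1s -fprod_piM.
by apply: PM => //; case: l.
Qed.

Lemma fprod_inlM (A B : groupType) : {morph @fprod_inl A B : x y / x * y}.
Proof.
move=> x y; rewrite [RHS]fprod_piM; apply/fprod_piP/fprod_sym.
exact: (fprod_mull [::] [::]).
Qed.

Lemma fprod_inrM (A B : groupType) : {morph @fprod_inr A B : x y / x * y}.
Proof.
move=> x y; rewrite [RHS]fprod_piM; apply/fprod_piP/fprod_sym.
exact: (fprod_mulr [::] [::]).
Qed.

HB.instance Definition _ (A B : groupType) :=
  isMultiplicative.Build _ _ (@fprod_inl A B) (@fprod_inlM A B).
HB.instance Definition _ (A B : groupType) :=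
  isMultiplicative.Build _ _ (@fprod_inr A B) (@fprod_inrM A B).

Section QuotientLift.
Variables (G K : groupType) (S : set G) (f : {multiplicative G -> K}).
Hypothesis fS : forall s, S s -> f s = 1.

(** The kernel of [f] is a normal subgroup containing [S], hence contains the smallest one. *)
Lemma normal_closure_kernel x : normal_closure S x -> f x = 1.
Proof.
move=> Sx; apply: (Sx [set y | f y = 1]); split; last exact: fS.
split; first split => [|y z /= fy fz|y /= fy]; first exact: multiplicative1.
- by rewrite gmulfM fy fz mulg1.
- by rewrite multiplicativeV fy invg1.
- by move=> y z /= fy; rewrite /conjg !gmulfM fy mul1g -gmulfM mulVg multiplicative1.
Qed.

Lemma quot_lift : exists F : {multiplicative quot_group S -> K},
  forall x, F (\pi_(quot_group S) x)%qT = f x.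
Proof.
pose F (a : quot_group S) : K := f (repr a).
have Fpi x : F (\pi_(quot_group S) x)%qT = f x.
  have /quot_piP/normal_closure_kernel :
    (\pi_(quot_group S) (repr (\pi_(quot_group S) x)) = \pi_(quot_group S) x)%qT.
    by rewrite reprK.
  rewrite gmulfM multiplicativeV => e.
  by apply: (mulgI (f (repr (\pi_(quot_group S)%qT x)))^-1); rewrite mulVg e.
have FM : {morph F : x y / x * y}.
  move=> x y; rewrite -[x]reprK -[y]reprK [X in F X]quot_piM.
  by rewrite !Fpi gmulfM.
pose hF := isMultiplicative.Build _ _ F FM.
pose F' : {multiplicative quot_group S -> K} := HB.pack F hF.
by exists F'.
Qed.

End QuotientLift.

Section HNNTheory.
Variables (G H : groupType) (i1 i2 : H -> G).

Definition hnn_pi (x : free_prod G Zcyc) : HNN i1 i2 :=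
  (\pi_(quot_group (hnn_relators i1 i2)) x)%qT.

Lemma hnn_piM : {morph hnn_pi : x y / x * y}.
Proof. by move=> x y; rewrite [RHS]quot_piM. Qed.

HB.instance Definition _ := isMultiplicative.Build _ _ hnn_pi hnn_piM.

Definition hnn_inl (g : G) : HNN i1 i2 := hnn_pi (fprod_inl Zcyc g).
Definition hnn_t : HNN i1 i2 := hnn_pi (stable_letter G).

Lemma hnn_inlM : {morph hnn_inl : x y / x * y}.
Proof. by move=> x y; rewrite /hnn_inl !gmulfM. Qed.

HB.instance Definition _ := isMultiplicative.Build _ _ hnn_inl hnn_inlM.

Lemma hnn_relation h : hnn_inl (i1 h) * hnn_t = hnn_t * hnn_inl (i2 h).
Proof.
rewrite -!hnn_piM; apply/quot_piP => N [[_ NJ] Nr].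
have {}/Nr Nh : hnn_relators i1 i2 ((fprod_inl Zcyc (i1 h))^-1 *
    stable_letter G * fprod_inl Zcyc (i2 h) * (stable_letter G)^-1) by exists h.
(* The quotient of the two sides is the relator conjugated by the stable letter. *)
by have := NJ _ (stable_letter G) Nh; rewrite /conjg invgM !mulgA mulgKV.
Qed.

(** [G] and [t] generate the extension, so asymptotic closeness of two families of maps can be
    checked on them. *)
Lemma hnn_ind (P : HNN i1 i2 -> Prop) :
  P 1 -> (forall x y, P x -> P y -> P (x * y)) -> (forall x, P x -> P x^-1) ->
  (forall g, P (hnn_inl g)) -> P hnn_t -> forall x, P x.
Proof.
move=> P1 PM PV Pl Pt x; rewrite -[x]reprK -/(hnn_pi _).
elim/fprod_ind: (repr x) => [|u v Pu Pv|//|z].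
- by rewrite multiplicative1.
- by rewrite hnn_piM; apply: PM.
(* A letter from the second factor is an arbitrary integer; its image is a power of [hnn_t]. *)
have -> : hnn_pi (fprod_inr G z) = expgz hnn_t z.
  pose F : {multiplicative Zcyc -> HNN i1 i2} := hnn_pi \o @fprod_inr G Zcyc.
  exact: (multiplicative_expgz F).
have PX n : P (hnn_t ^+ n) by elim: n => [//|n IHn]; rewrite expgS; apply: PM.
by case: z => n; [apply: PX | apply/PV/PX].
Qed.

Lemma hnn_lift (K : groupType) (f : {multiplicative G -> K}) (t : K) :
    (forall h, f (i1 h) * t = t * f (i2 h)) ->
  exists F : {multiplicative HNN i1 i2 -> K},
    (forall g, F (hnn_inl g) = f g) /\ F hnn_t = t.
Proof.
move=> ft; pose L : {multiplicative free_prod G Zcyc -> K} :=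
  fprod_lift f (expgz t).
have Ll g : L (fprod_inl _ g) = f g by exact: fprod_lift_inl.
have Lt : L (stable_letter G) = t by exact: fprod_lift_inr.
have LS s : hnn_relators i1 i2 s -> L s = 1.
  move=> [h _ <-]; rewrite !gmulfM !multiplicativeV !Ll Lt.
  by rewrite -(mulgA _ t) -ft mulKg mulgV.
have [F FE] := quot_lift LS.
by exists F; split=> [g|]; rewrite FE.
Qed.

End HNNTheory.

(** * Reduction to correcting almost commuting elements *)

Section MetricClass.
Variables (R : realType) (C : metric_class R).

Record biinvariant : Prop := Biinvariant {
  mc_dist_refl : forall (X : mc_obj C) (a : mc_aut X), mc_dist a a = 0%R;
  mc_distC : forall (X : mc_obj C) (a b : mc_aut X), mc_dist a b = mc_dist b a;
  mc_dist_triangle : forall (X : mc_obj C) (a b c : mc_aut X),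
    (mc_dist a c <= mc_dist a b + mc_dist b c)%R;
  mc_distMl : forall (X : mc_obj C) (a b c : mc_aut X),
    mc_dist (c * a) (c * b) = mc_dist a b;
  mc_distMr : forall (X : mc_obj C) (a b c : mc_aut X),
    mc_dist (a * c) (b * c) = mc_dist a b
}.

(* The bound is uniform in [X]. The slack [e] pays for making a matrix
   invertible before its polar decomposition is taken. *)
Definition correctable (H : finGroupType) : Prop :=
  forall (X : mc_obj C) (rho : {multiplicative H -> mc_aut X}) (t : mc_aut X)
    (e : R), (0 < e)%R ->
  exists2 u : mc_aut X, forall h, commute (rho h) u &
    (mc_dist t u <= 2 * (\sum_h mc_dist (rho h * t) (t * rho h)) + e)%R.

Hypothesis bi : biinvariant.

Lemma mc_dist_ge0 (X : mc_obj C) (a b : mc_aut X) : (0 <= mc_dist a b)%R.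
Proof.
have := mc_dist_triangle bi a b a; rewrite (mc_dist_refl bi) (mc_distC bi b a).
by rewrite -mulr2n pmulrn_lge0.
Qed.

Section Asymptotic.
Variable X : nat -> mc_obj C.
Implicit Types u v w : forall n, mc_aut (X n).

(** Equality modulo null sequences; biinvariance makes it a congruence for pointwise products. *)
Definition asymp u v : Prop := mc_dist (u n) (v n) @[n --> \oo] --> (0%R : R).

Lemma asymp_le u v (e : nat -> R) :
  (forall n, (mc_dist (u n) (v n) <= e n)%R) -> e n @[n --> \oo] --> (0%R : R) ->
  asymp u v.
Proof.
move=> ue; apply: (squeeze_cvgr _ (cvg_cst 0%R)).
by apply: nearW => n; rewrite mc_dist_ge0 ue.
Qed.

Lemma asymp_eq u v : (forall n, u n = v n) -> asymp u v.
Proof.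
move=> uv; apply: (@asymp_le _ _ (fun=> 0%R)) => [n|]; last exact: cvg_cst.
by rewrite uv (mc_dist_refl bi).
Qed.

Lemma asymp_refl u : asymp u u.
Proof. exact: asymp_eq. Qed.

Lemma asymp_sym u v : asymp u v -> asymp v u.
Proof. by move=> uv; apply: asymp_le uv => n; rewrite (mc_distC bi). Qed.

Lemma asymp_trans u v w : asymp u v -> asymp v w -> asymp u w.
Proof.
move=> uv vw; apply: asymp_le (fun n => mc_dist_triangle bi _ (v n) _) _.
by rewrite -[X in _ --> X]addr0; apply: cvgD.
Qed.

Lemma asymp_mul u u' v v' : asymp u u' -> asymp v v' ->
  asymp (fun n => u n * v n) (fun n => u' n * v' n).
Proof.
(* One factor is changed at a time, and translation invariance removes the other. *)
move=> uu vv; apply: (@asymp_trans _ (fun n => u' n * v n)).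
  by apply: asymp_le uu => n; rewrite (mc_distMr bi).
by apply: asymp_le vv => n; rewrite (mc_distMl bi).
Qed.

Lemma asymp_mulIl u v w :
  asymp (fun n => w n * u n) (fun n => w n * v n) -> asymp u v.
Proof. by apply: asymp_le => n; rewrite (mc_distMl bi). Qed.

Lemma asymp_commute_correctable (H : finGroupType)
    (rho : forall n, {multiplicative H -> mc_aut (X n)}) u :
  correctable H ->
  (forall h, asymp (fun n => rho n h * u n) (fun n => u n * rho n h)) ->
  exists2 v, (forall n h, commute (rho n h) (v n)) & asymp u v.
Proof.
move=> Hcor rhou.
have e_gt0 n : (0 < harmonic n :> R)%R by exact: harmonic_gt0.
(* The correction is made separately for each [n] with slack 1/(n+1). The error stays null because
   the sum over the finite group [H] has a fixed number of null terms. *)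
pose v n := s2val (cid2 (Hcor (X n) (rho n) (u n) (harmonic n) (e_gt0 n))).
exists v => [n|]; first by rewrite /v; case: cid2.
apply: (asymp_le (e := fun n =>
  (2 * (\sum_h mc_dist (rho n h * u n) (u n * rho n h)) + harmonic n)%R)).
  by move=> n; rewrite /v; case: cid2.
rewrite -[X in _ --> X]addr0; apply: cvgD; last exact: cvg_harmonic.
rewrite -[X in _ --> X](mulr0 2%R); apply: cvgMr.
have {2}-> : (0 = \sum_(h : H) 0 :> R)%R by rewrite big1.
by apply: (@cvg_big _ _ _ _ _ add_continuous) => h _; exact: rhou.
Qed.

End Asymptotic.

Lemma stable_HNN (G : groupType) (H : finGroupType) (i : {multiplicative H -> G}) :
  correctable H -> stable C G -> stable C (HNN i i).
Proof.
move=> Hcor Gst X phi phiM.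
(* phi(1) phi(1) is close to phi(1), and one factor cancels. *)
have phi1 : asymp (fun n => phi n 1) (fun n => 1).
  apply: (@asymp_mulIl _ _ _ (fun n => phi n 1)).
  apply: asymp_trans (phiM 1 1) _.
  by apply: asymp_eq => n; rewrite !mulg1.
have phiGM (g h : G) :
  asymp (fun n => phi n (hnn_inl i i g) * phi n (hnn_inl i i h))
    (fun n => phi n (hnn_inl i i (g * h))).
  by rewrite gmulfM; apply: phiM.
have [psi psiP] := Gst X (fun n g => phi n (hnn_inl i i g)) phiGM.
pose t : HNN i i := hnn_t i i.
pose rho n : {multiplicative H -> mc_aut (X n)} := psi n \o i.
(* On [i h] the maps [psi] and [phi] are asymptotically equal, and [phi] almost respects the
   defining relation. *)
have rhot h : asymp (fun n => rho n h * phi n t) (fun n => phi n t * rho n h).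
  apply: asymp_trans (asymp_mul (asymp_sym (psiP _)) (asymp_refl _)) _.
  apply: asymp_trans (phiM _ _) _; rewrite hnn_relation; apply: asymp_sym.
  apply: asymp_trans (asymp_mul (asymp_refl _) (asymp_sym (psiP _))) _.
  exact: phiM.
have [v vrho vt] := asymp_commute_correctable Hcor rhot.
pose Psi n := sval (cid (hnn_lift (i1 := i) (i2 := i) (f := psi n) (vrho n))).
have PsiG n g : Psi n (hnn_inl i i g) = psi n g.
  by rewrite /Psi; case: cid => F [].
have Psit n : Psi n t = v n by rewrite /Psi; case: cid => F [].
exists Psi; apply: hnn_ind => [|x y Px Py|x Px|g|].
- by apply: asymp_trans phi1 (asymp_eq _) => n; rewrite multiplicative1.
- apply: asymp_trans (asymp_sym (phiM _ _)) (asymp_trans (asymp_mul Px Py) _).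
  by apply: asymp_eq => n; rewrite gmulfM.
(* Psi(x) phi(x^-1) is close to phi(x) phi(x^-1), hence to phi(1) and to 1 = Psi(x) Psi(x^-1). *)
- apply: (@asymp_mulIl _ _ _ (fun n => Psi n x)).
  apply: asymp_trans (asymp_mul (asymp_sym Px) (asymp_refl _)) _.
  apply: asymp_trans (phiM _ _) _; rewrite mulgV.
  apply: asymp_trans phi1 (asymp_eq _) => n.
  by rewrite -gmulfM mulgV multiplicative1.
- by apply: asymp_trans (psiP g) (asymp_eq _) => n; rewrite PsiG.
- by apply: asymp_trans vt (asymp_eq _) => n; rewrite Psit.
Qed.

End MetricClass.

(** * Permutations *)

Section Hamming.
Variables (R : realType) (X : finType).
Implicit Types a b c s : {perm X}.

Lemma hamming_dist_refl a : hamming_dist R a a = 0%R.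
Proof. by rewrite /hamming_dist eq_card0 ?mul0r // => x; rewrite !inE eqxx. Qed.

Lemma hamming_distC a b : hamming_dist R a b = hamming_dist R b a.
Proof. by congr (_%:R / _)%R; apply: eq_card => x; rewrite !inE eq_sym. Qed.

Lemma hamming_dist_le a b (N : nat) :
  (#|[pred x | a x != b x]| <= N)%N -> (hamming_dist R a b <= N%:R / #|X|%:R)%R.
Proof. by move=> abN; rewrite ler_wpM2r ?invr_ge0 ?ler_nat. Qed.

Lemma hamming_dist_triangle a b c :
  (hamming_dist R a c <= hamming_dist R a b + hamming_dist R b c)%R.
Proof.
rewrite -mulrDl -natrD; apply: hamming_dist_le.
rewrite -cardUI; apply: leq_trans (leq_addr _ _).
apply/subset_leq_card/fintype.subsetP => x.
by rewrite !inE -negb_and; apply: contraNN => /andP[/eqP-> /eqP->].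
Qed.

Lemma hamming_distMl a b c : hamming_dist R (c * a) (c * b) = hamming_dist R a b.
Proof.
(* Since [c] acts first, it maps the disagreement set of [c * a] and [c * b] bijectively onto that
   of [a] and [b]. *)
congr (_%:R / _)%R; rewrite -[LHS](fintype.card_image (@perm_inj _ c)).
apply: eq_card => x; rewrite -[x](permKV c) fintype.mem_image ?inE ?permM //.
exact: perm_inj.
Qed.

Lemma hamming_distMr a b c : hamming_dist R (a * c) (b * c) = hamming_dist R a b.
Proof.
by congr (_%:R / _)%R; apply: eq_card => x;
  rewrite !inE !permM (eqtype.inj_eq perm_inj).
Qed.

End Hamming.

Lemma C_P_biinvariant (R : realType) : biinvariant (C_P R).
Proof.
split=> X /=; [exact: hamming_dist_refl | exact: hamming_distC
  | exact: hamming_dist_triangle | exact: hamming_distMl | exact: hamming_distMr].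
Qed.

(** * First return maps and equivariant permutations *)

Section FirstReturn.
Variables (X : finType) (p : {perm X}) (B : {set X}).

Lemma return_time x : x \in B -> exists m, iter m.+1 p x \in B.
Proof.
by exists #[p].-1; rewrite prednK ?order_gt0 // -permX expg_order perm1.
Qed.

Lemma first_return : exists r : {perm X},
  (forall x, x \notin B -> r x = x) /\
  (forall x, x \in B -> exists m,
     [/\ r x = iter m.+1 p x, iter m.+1 p x \in B &
         forall j, (j < m)%N -> iter j.+1 p x \notin B]).
Proof.
have /choice[f fP] x : exists y, (x \notin B -> y = x) /\
  (x \in B -> exists m, [/\ y = iter m.+1 p x, iter m.+1 p x \in B &
     forall j, (j < m)%N -> iter j.+1 p x \notin B]).
  have [xB|] := boolP (x \in B); last by exists x.
  case: (ex_minnP (return_time xB)) => m mB m_min.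
  exists (iter m.+1 p x); split=> // _; exists m; split=> // j.
  by apply: contraTN => /m_min; rewrite -leqNgt.
have fN x : x \notin B -> f x = x by case: (fP x).
have fB x (xB : x \in B) := (fP x).2 xB.
have f_inj : injective f.
  (* Cancelling [m.+1] steps turns equal return points into x = p^(n-m) y. If m < n, then [y] would
     return to [B] before its first return time. *)
  suff H x y m n : (m <= n)%N -> iter m.+1 p x = iter n.+1 p y -> x \in B ->
     (forall j, (j < n)%N -> iter j.+1 p y \notin B) -> x = y.
    move=> x y; have [xB|xB] := boolP (x \in B); have [yB|yB] := boolP (y \in B).
    - have [m [-> _ m_min]] := fB x xB; have [n [-> _ n_min]] := fB y yB => e.
      have [mn|/ltnW nm] := leqP m n; first exact: H mn e xB n_min.
      by apply/esym/(H _ _ _ _ nm (esym e)).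
    - by have [m [-> mB _]] := fB x xB; rewrite (fN y yB) => e;
         rewrite e (negPf yB) in mB.
    - by have [m [-> mB _]] := fB y yB; rewrite (fN x xB) => e;
         rewrite -e (negPf xB) in mB.
    - by rewrite !fN.
  move=> mn; rewrite -(subnKC mn) -addSn iterD -!permX => /perm_inj ->.
  rewrite permX subnKC //; case: (n - m)%N (leq_subr m n) => [//|k] kn yB.
  by move=> /(_ k kn); rewrite yB.
exists (perm f_inj); split=> x xB; rewrite permE; [exact: fN | exact: fB].
Qed.

End FirstReturn.
(** Union bound by double counting: a point of the union is counted at least once on the right. *)
Lemma leq_card_exists (X I : finType) (P : I -> pred X) :
  (#|[pred x | [exists i, P i x]]| <= \sum_i #|P i|)%N.
Proof.
under eq_bigr do rewrite -sum1_card big_mkcond.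
rewrite exchange_big -sum1_card big_mkcond; apply: leq_sum => x _.
case: ifP => // /existsP[i Pix]; rewrite (bigD1 i) //= unfold_in.
by rewrite Pix.
Qed.

Section CommutingPerm.
Variables (X : finType) (H : finGroupType) (rho : {multiplicative H -> {perm X}}).
Variable s : {perm X}.

Definition noncommuting : {set X} :=
  [set x | [exists h, (rho h * s) x != (s * rho h) x]].

Let N := noncommuting.

Lemma noncommutingN x h : x \notin N -> s (rho h x) = rho h (s x).
Proof.
by rewrite inE negb_exists => /forallP/(_ h); rewrite !permM negbK => /eqP.
Qed.

Lemma noncommuting_rho x h : (rho h x \in N) = (x \in N).
Proof.
(* For a good [y], equivariance at [y] under both [k] and [k * g] yields equivariance at [rho k y]
   under [g]. The converse inclusion uses the inverse of [h]. *)
suff sub y k : y \notin N -> rho k y \notin N.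
  apply/idP/idP; apply: contraTT; first exact: sub.
  by move=> /(sub _ h^-1); rewrite multiplicativeV permK.
move=> yN; rewrite inE negb_exists; apply/forallP => g; rewrite negbK !permM.
have E z : rho g (rho k z) = rho (k * g) z by rewrite gmulfM permM.
by rewrite (noncommutingN _ yN) !E noncommutingN.
Qed.

(* The correction keeps [s] where it is equivariant and, elsewhere, closes up
   the paths of the partial bijection: [x] is sent to the point at which
   the backward orbit of [x] under [s] leaves the image of the good set. *)
Lemma commuting_perm : exists2 t : {perm X}, forall h, commute (rho h) t &
  forall x, x \notin N -> t x = s x.
Proof.
have [r [rN rB]] := first_return s^-1 N.
exists (r * s) => [h|x xN]; last by rewrite permM rN.
apply/permP => x; rewrite !permM.
have [xN|xN] := boolP (x \in N); last first.
  by rewrite !rN ?noncommuting_rho // noncommutingN.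
have [m [-> mN m_min]] := rB x xN.
have [m' [-> m'N m'_min]] : exists m, _ :=
  rB (rho h x) (etrans (noncommuting_rho x h) xN).
rewrite !iterS !permKV.
(* Before the first return the backward orbit of [x] stays in the good set, where [s] commutes with
   [rho h]; so [rho h] carries it to the backward orbit of [rho h x]. *)
have iterh j : (j <= m)%N -> iter j s^-1%g (rho h x) = rho h (iter j s^-1%g x).
  elim: j => // j IHj jm; rewrite 2!iterS IHj 1?ltnW //.
  by rewrite -{1}[iter j _ x](permKV s) -noncommutingN ?permK // m_min.
(* Were this point good, equivariance under the inverse of [h] would send it to s^-(m+1) x, which
   would then be good by invariance. *)
have mhN : iter m.+1 s^-1%g (rho h x) \in N.
  apply: contraTT mN => yN.
  have := noncommutingN h^-1 yN; rewrite !iterS permKV iterh //.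
  rewrite multiplicativeV permK => /(canRL (permK s)) <-.
  by rewrite -multiplicativeV noncommuting_rho -iterh.
have -> : m' = m; last exact: iterh.
apply/eqP; rewrite eqn_leq; apply/andP; split; rewrite leqNgt.
  by apply/negP => /m'_min; rewrite mhN.
apply/negP => m'm; have := m_min _ m'm.
by rewrite -(noncommuting_rho _ h) -iterh // m'N.
Qed.

End CommutingPerm.

Lemma C_P_correctable (R : realType) (H : finGroupType) : correctable (C_P R) H.
Proof.
move=> X rho s e e_gt0; have [t tc ts] := commuting_perm rho s.
exists t => //=.
set S := (\sum_h _)%R.
(* [s] and [t] differ only on the noncommuting set, the union over [h] of the sets counted in [S];
   so even a single [S] bounds the distance. *)
suff stS : (hamming_dist R s t <= S)%R.
  apply: (le_trans stS); rewrite mulr_natl mulr2n -addrA lerDl.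
  apply: addr_ge0 (ltW e_gt0); apply: le_trans stS.
  exact: (mc_dist_ge0 (C_P_biinvariant R)).
rewrite /S -mulr_suml -natr_sum; apply: hamming_dist_le.
apply: leq_trans (leq_card_exists _); apply/subset_leq_card/fintype.subsetP => x.
rewrite !inE; apply: contraNT => xN; by rewrite ts ?inE.
Qed.

(** * Unitary matrices *)

Lemma nonneg_quadratic (F : realFieldType) (a p b : F) : (0 <= a)%R ->
  (forall t : F, 0 <= t ^+ 2 * a + 2 * (t * p) + b)%R -> (p ^+ 2 <= a * b)%R.
Proof.
move=> a_ge0 quad; have [a0|a_neq0] := eqVneq a 0%R.
  have [->|p_neq0] := eqVneq p 0%R; first by rewrite a0 expr0n mul0r.
  (* For [a = 0] this value makes the affine function equal to -1. *)
  have := quad (- ((b + 1) / (2 * p)))%R.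
  rewrite a0 mulr0 (_ : - _ * p = - ((b + 1) / 2))%R; last by field.
  by lra.
have a_gt0 : (0 < a)%R by rewrite lt0r a_neq0.
(* The minimiser of the quadratic. *)
have := quad (- (p / a))%R.
have -> : ((- (p / a)) ^+ 2 * a + 2 * (- (p / a) * p) + b = b - p ^+ 2 / a)%R by field.
by rewrite subr_ge0 ler_pdivrMr // mulrC.
Qed.

Section PolarDecomposition.
Variables (C : numClosedFieldType) (n : nat).
Local Open Scope ring_scope.
Local Open Scope sesquilinear_scope.
Implicit Types A B M T U V P : 'M[C]_n.

Lemma trmxC_mul A B : (A *m B)^t* = B^t* *m A^t*.
Proof. by rewrite trmx_mul map_mxM. Qed.

Lemma mxtrace_sq A : \tr (A^t* *m A) = \sum_i \sum_j `|A j i| ^+ 2.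
Proof.
apply: eq_bigr => i _; rewrite mxE; apply: eq_bigr => j _.
by rewrite !mxE mulrC -normCK.
Qed.

Lemma unitarymx_entry_le1 U i : U \is unitarymx -> `|U i i| <= 1.
Proof.
move=> /unitarymxP/matrixP/(_ i i); rewrite !mxE eqxx mulr1n => E.
rewrite -(@expr_le1 _ 2) // -E (bigD1 i) //= !mxE -normCK lerDl.
by apply: sumr_ge0 => j _; rewrite !mxE -normCK exprn_ge0.
Qed.

(** [V] commutes with [A], so its inverse V^* does too; then take adjoints. *)
Lemma unitarymx_commuteV V A : V \is unitarymx ->
  V *m A = A *m V -> V *m A^t* = A^t* *m V.
Proof.
move=> Vu VA; have VV := mulmx1C (unitarymxP Vu).
have VA' : V^t* *m A = A *m V^t*.
  by rewrite -[LHS](mulmxtVK _ Vu) -(mulmxA _ A) -VA mulmxA VV mul1mx.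
by rewrite -[V in LHS]trmxCK -trmxC_mul -VA' trmxC_mul trmxCK.
Qed.

(** U = A (A^*A)^(-1/2), computed in an eigenbasis of A^*A. The positive factor is kept in
    diagonalized form for the trace estimate of [polar_nearest]. *)
Lemma polar_decomposition A : A \in unitmx -> exists U P (s : 'I_n -> C), [/\
  U \is unitarymx, P \is unitarymx, forall i, 0 < s i,
  A = U *m P^t* *m diag_mx (\row_i s i) *m P &
  forall V, V \is unitarymx -> V *m A = A *m V -> V *m U = U *m V].
Proof.
move=> Au; have [S SA] : exists S, S = A^t* *m A by exists (A^t* *m A).
pose P := spectralmx S; pose d := spectral_diag S.
have Pu : P \is unitarymx by exact: spectral_unitarymx.
have PP : P^t* *m P = 1%:M by exact/mulmx1C/unitarymxP.
have SE : S = P^t* *m diag_mx d *m P.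
  rewrite -invmx_unitary //; apply/orthomx_spectralP/normalmxP.
  by rewrite SA !trmxC_mul !trmxCK.
have [B BA] : exists B, B = A *m P^t* by exists (A *m P^t* ).
have BB : B^t* *m B = diag_mx d.
  rewrite BA trmxC_mul trmxCK !mulmxA -(mulmxA P) -SA SE !mulmxA.
  by rewrite (unitarymxP Pu) mul1mx -mulmxA (unitarymxP Pu) mulmx1.
have d_ge0 i : 0 <= d 0 i.
  have := congr1 (fun M : 'M[C]_n => M i i) BB; rewrite !mxE eqxx mulr1n => <-.
  by apply: sumr_ge0 => j _; rewrite !mxE mulrC -normCK exprn_ge0.
have Bu : B \in unitmx.
  by rewrite BA unitmx_mul Au unitarymx_unit // trmxC_unitary.
have d_neq0 i : d 0 i != 0.
  have : diag_mx d \in unitmx.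
    by rewrite -BB unitmx_mul Bu andbT map_unitmx unitmx_tr.
  rewrite unitmxE det_diag unitfE; apply: contraNneq => di0.
  by rewrite (bigD1 i) //= di0 mul0r.
pose s i := sqrtC (d 0 i).
have s_gt0 i : 0 < s i by rewrite sqrtC_gt0 lt0r d_neq0 d_ge0.
pose D := diag_mx (\row_i s i); pose DV := diag_mx (\row_i (s i)^-1).
have DDV : D *m DV = 1%:M.
  apply/matrixP => i j; rewrite mul_diag_mx !mxE; case: eqVneq => [->|_].
    by rewrite !mulr1n mulfV // gt_eqF.
  by rewrite !mulr0n mulr0.
have DVD : DV *m D = 1%:M by exact: mulmx1C.
have DD : D *m D = diag_mx d.
  apply/matrixP => i j; rewrite mul_diag_mx !mxE; case: eqVneq => [->|_].
    by rewrite !mulr1n -expr2 sqrtCK.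
  by rewrite !mulr0n mulr0.
have DVh : DV^t* = DV.
  apply/matrixP => i j; rewrite !mxE eq_sym; case: eqVneq => [->|_].
    by rewrite !mulr1n; apply/conj_Creal/gtr0_real; rewrite invr_gt0.
  by rewrite !mulr0n conjC0.
have [U UB] : exists U, U = B *m DV *m P by exists (B *m DV *m P).
have AE : A = U *m P^t* *m D *m P.
  by rewrite UB (mulmxtVK _ Pu) -(mulmxA B) DVD mulmx1 BA -mulmxA PP mulmx1.
have Uu : U \is unitarymx.
  apply/unitarymxP/mulmx1C; rewrite UB !trmxC_mul DVh !mulmxA.
  rewrite -(mulmxA _ _ B) BB -DD !mulmxA -(mulmxA _ DV D) DVD mulmx1.
  by rewrite -(mulmxA _ D DV) DDV mulmx1.
exists U, P, s; split=> // V Vu VA.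
have [M ME] : exists M, M = P *m V *m P^t* by exists (P *m V *m P^t* ).
have VS : V *m S = S *m V.
  by rewrite SA mulmxA unitarymx_commuteV // -!mulmxA VA.
have Md : M *m diag_mx d = diag_mx d *m M.
  have -> : diag_mx d = P *m S *m P^t*.
    by rewrite SE !mulmxA (unitarymxP Pu) mul1mx -mulmxA (unitarymxP Pu) mulmx1.
  rewrite ME !mulmxA !(mulmxKtV _ Pu) //.
  by rewrite -(mulmxA P V) -(mulmxA P S) VS.
(* An entry of [M] between distinct eigenvalues of [diag_mx d] vanishes, so [M] commutes with every
   function of that matrix, here its inverse square root. *)
have MD : M *m DV = DV *m M.
  apply/matrixP => i j; rewrite mul_mx_diag mul_diag_mx !mxE.
  have /matrixP/(_ i j) := Md; rewrite mul_mx_diag mul_diag_mx !mxE => /eqP.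
  rewrite mulrC -subr_eq0 -mulrBl mulf_eq0 subr_eq0 => /orP[/eqP dij|/eqP->].
    by rewrite mulrC /s dij.
  by rewrite mul0r mulr0.
have VE : V *m P^t* = P^t* *m M.
  by rewrite ME !mulmxA PP mul1mx.
have MP : M *m P = P *m V.
  by rewrite ME (mulmxKtV _ Pu).
rewrite UB BA !mulmxA VA -(mulmxA A V) VE -!mulmxA; congr (A *m (P^t* *m _)).
by rewrite mulmxA MD -mulmxA MP.
Qed.

End PolarDecomposition.

(** * The real Euclidean structure on complex matrices and the nearest unitary *)

Section FrobeniusProduct.
Variables (R : realType) (n : nat).
Local Open Scope ring_scope.
Local Open Scope sesquilinear_scope.
Local Notation Re := complex.Re.
Implicit Types A B M T U : 'M[R[i]]_n.

Lemma ReD (x y : R[i]) : Re (x + y) = Re x + Re y.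
Proof. by case: x; case: y. Qed.

Lemma ReMr (r : R) (x : R[i]) : Re (r%:C%C * x) = r * Re x.
Proof. by case: x => a b /=; rewrite mul0r subr0. Qed.

Lemma Re_conj (x : R[i]) : Re x^* = Re x.
Proof. by case: x. Qed.

Lemma Re_ge0 (x : R[i]) : 0 <= x -> 0 <= Re x.
Proof. by rewrite lecE => /andP[]. Qed.

Lemma Re_le_norm (x : R[i]) : (Re x)%:C%C <= `|x|.
Proof. by apply: le_trans (normc_ge_Re x); rewrite lecR ler_norm. Qed.

(** The real part of the Hilbert-Schmidt product, with unnormalized trace: a real symmetric bilinear
    form. *)
Definition mxip A B : R := Re (\tr (A^t* *m B)).
Definition mxsq A : R := mxip A A.

Lemma mxipDr A B M : mxip A (B + M) = mxip A B + mxip A M.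
Proof. by rewrite /mxip mulmxDr mxtraceD ReD. Qed.

Lemma mxipC A B : mxip A B = mxip B A.
Proof.
rewrite /mxip -Re_conj -[A in RHS]trmxCK -trmxC_mul.
by rewrite trace_map_mx mxtrace_tr.
Qed.

Lemma mxipNr A B : mxip A (- B) = - mxip A B.
Proof. by apply/eqP; rewrite -addr_eq0 -mxipDr addNr /mxip mulmx0 mxtrace0. Qed.

Lemma mxipZr (r : R) A B : mxip A (r%:C%C *: B) = r * mxip A B.
Proof. by rewrite /mxip -scalemxAr mxtraceZ ReMr. Qed.

Lemma mxsqD A B : mxsq (A + B) = mxsq A + 2 * mxip A B + mxsq B.
Proof.
rewrite /mxsq mxipDr ![mxip (A + B) _]mxipC !mxipDr (mxipC B A).
by rewrite mulr_natl mulr2n !addrA.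
Qed.

Lemma mxsqZ (r : R) A : mxsq (r%:C%C *: A) = r ^+ 2 * mxsq A.
Proof. by rewrite /mxsq mxipZr mxipC mxipZr mulrA -expr2. Qed.

Lemma mxsq_ge0 A : 0 <= mxsq A.
Proof.
apply: Re_ge0; rewrite mxtrace_sq.
by apply: sumr_ge0 => i _; apply: sumr_ge0 => j _; rewrite exprn_ge0.
Qed.

Lemma mxsqN A : mxsq (- A) = mxsq A.
Proof. by rewrite /mxsq /mxip [(- A)^T]linearN map_mxN mulNmx mulmxN opprK. Qed.

(** Cauchy-Schwarz: the squared norm of tA + B is a nonnegative quadratic in the real variable t. *)
Lemma mxip_le A B : mxip A B <= Num.sqrt (mxsq A) * Num.sqrt (mxsq B).
Proof.
rewrite -sqrtrM ?mxsq_ge0 //; apply: le_trans (ler_norm _) _.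
rewrite -sqrtr_sqr; apply/ler_wsqrtr/nonneg_quadratic => [|t]; first exact: mxsq_ge0.
have := mxsq_ge0 (t%:C%C *: A + B).
by rewrite mxsqD mxsqZ mxipC mxipZr mxipC.
Qed.

Definition frob A : R := Num.sqrt (mxsq A).

Lemma frobD A B : frob (A + B) <= frob A + frob B.
Proof.
have N_ge0 M : 0 <= frob M by exact: sqrtr_ge0.
rewrite -ler_sqr ?nnegrE ?addr_ge0 ?N_ge0 // sqrrD.
rewrite !sqr_sqrtr ?mxsq_ge0 // mxsqD.
by rewrite lerD2r lerD2l -[leRHS]mulr_natl ler_pM2l ?mxip_le.
Qed.

Lemma mxsq_mull U A : U \is unitarymx -> mxsq (U *m A) = mxsq A.
Proof.
move=> Uu; rewrite /mxsq /mxip trmxC_mul mulmxA -(mulmxA (A^t*)).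
have /unitarymxP := Uu; rewrite -trmxC_unitary in Uu.
by move/unitarymxP: Uu; rewrite trmxCK => -> _; rewrite mulmx1.
Qed.

Lemma mxsq_mulr U A : U \is unitarymx -> mxsq (A *m U) = mxsq A.
Proof.
move=> /unitarymxP Uu; rewrite /mxsq /mxip trmxC_mul mxtrace_mulC mulmxA.
by rewrite -(mulmxA A) Uu mulmx1 mxtrace_mulC.
Qed.

Lemma HS_normE A : HS_norm A = frob A * Num.sqrt n%:R^-1.
Proof.
rewrite /HS_norm -sqrtrM ?mxsq_ge0 //; congr Num.sqrt.
by rewrite mulrC -[n%:R](rmorph_nat (real_complex R)) -fmorphV ReMr mulrC.
Qed.

Lemma frobN A : frob (- A) = frob A.
Proof. by rewrite /frob mxsqN. Qed.

Lemma frobZ (r : R) A : 0 <= r -> frob (r%:C%C *: A) = r * frob A.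
Proof. by move=> r0; rewrite /frob mxsqZ sqrtrM ?sqr_ge0 // sqrtr_sqr ger0_norm. Qed.

Lemma frob_sum (I : finType) (F : I -> 'M[R[i]]_n) :
  frob (\sum_i F i) <= \sum_i frob (F i).
Proof.
elim/big_ind2: _ => [|x a y b xa yb|//].
  by rewrite /frob /mxsq /mxip mulmx0 mxtrace0 sqrtr0.
exact: le_trans (frobD _ _) (lerD xa yb).
Qed.

Lemma unitary_sq_const U : U \is unitarymx -> mxsq U = n%:R.
Proof.
move=> /unitarymxP/mulmx1C Uu; rewrite /mxsq /mxip Uu mxtrace1.
by rewrite -[n%:R](rmorph_nat (real_complex R)).
Qed.

(** All unitaries have the same norm, so a nearest one maximizes Re Tr(T^* A). That trace is the sum
    of Re(W_ii) s_i with W = P T^* U P^* unitary. Its diagonal entries have modulus at most 1, and W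
    = 1 when T = U. *)
Lemma polar_nearest A U P (s : 'I_n -> R[i]) : U \is unitarymx ->
    P \is unitarymx -> (forall i, 0 < s i) ->
    A = U *m P^t* *m diag_mx (\row_i s i) *m P ->
  forall T, T \is unitarymx -> frob (A - U) <= frob (A - T).
Proof.
move=> Uu Pu s_gt0 AE.
have ipA T : mxip T A = \sum_i Re ((P *m T^t* *m U *m P^t*) i i * s i).
  rewrite /mxip [in LHS]AE !mulmxA mxtrace_mulC !mulmxA.
  rewrite /mxtrace raddf_sum; apply: eq_bigr => i _.
  by rewrite mul_mx_diag !mxE.
have ipT T : T \is unitarymx -> mxip T A <= mxip U A.
  move=> Tu; rewrite !ipA; apply: ler_sum => i _.
  have WU : P *m T^t* *m U *m P^t* \is unitarymx.
    have PVu : P^t* \is unitarymx by rewrite trmxC_unitary.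
    have TVu : T^t* \is unitarymx by rewrite trmxC_unitary; exact: Tu.
    exact: mul_unitarymx (mul_unitarymx (mul_unitarymx Pu TVu) Uu) PVu.
  rewrite -(mulmxA P (U^t* ) U) (mulmx1C (unitarymxP Uu)) mulmx1 (unitarymxP Pu).
  rewrite [1%:M i i]mxE eqxx mul1r.
  rewrite -lecR; apply: le_trans (Re_le_norm _) _.
  rewrite normrM (gtr0_norm (s_gt0 i)) -[leRHS]/((Re (s i))%:C)%C.
  rewrite RRe_real ?gtr0_real //.
  by apply: ler_piMl; [exact: ltW | exact: unitarymx_entry_le1].
move=> T Tu; apply: ler_wsqrtr.
rewrite !mxsqD !mxsqN (unitary_sq_const Uu) (unitary_sq_const Tu).
rewrite !mxipNr ![mxip A _]mxipC.
rewrite lerD2r lerD2l ler_pM2l ?ltr0n // lerN2; exact: ipT.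
Qed.

End FrobeniusProduct.

(** * Invertibility after a scalar shift *)

Section Perturbation.
Local Open Scope ring_scope.

Lemma poly_nonroot (F : idomainType) (p : {poly F}) (c : nat -> F) :
  p != 0 -> injective c -> exists k, ~~ root p (c k).
Proof.
move=> p0 c_inj; apply: contrapT => /forallNP pc.
have := max_poly_roots (rs := map c (iota 0 (size p))) p0.
rewrite size_map size_iota ltnn => H; suff: false by [].
apply: H; last by rewrite map_inj_uniq ?iota_uniq.
by apply/allP => _ /mapP[k _ ->]; apply: contrapT => /negP; apply: pc.
Qed.

(** The shifted matrix is singular only if [c k] is an eigenvalue of [- A], that is, a root of a
    nonzero polynomial. *)
Lemma unitmx_perturb (F : fieldType) n (A : 'M[F]_n) (c : nat -> F) :
  injective c -> exists k, A + (c k)%:M \in unitmx.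
Proof.
move=> c_inj; have [|//|k] := @poly_nonroot _ (char_poly (- A)) c.
  by rewrite monic_neq0 ?char_poly_monic.
rewrite -eigenvalue_root_char => /negP kA; exists k.
apply: contrapT => /negP Au; apply: kA.
rewrite /eigenvalue /eigenspace kermx_eq0 row_free_unit; apply: contraNN Au.
by rewrite -opprD -scaleN1r unitmxZ ?unitrN1.
Qed.

End Perturbation.

(** * Correction of unitaries in the normalized Hilbert-Schmidt distance *)

Section UnitaryClass.
Variable (R : realType).
Local Open Scope ring_scope.
Local Open Scope sesquilinear_scope.

Lemma HS_distE n (a b : unitary R[i] n) :
  HS_dist a b = frob (unitary_mx a - unitary_mx b) * Num.sqrt n%:R^-1.
Proof. exact: HS_normE. Qed.

Lemma C_HS_biinvariant : biinvariant (C_HS R).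
Proof.
have D n (a b : @mc_aut R (C_HS R) n) : mc_dist a b = HS_dist (a : unitary _ n) b.
  by [].
split=> [n a|n a b|n a b c|n a b c|n a b c]; rewrite !D !HS_distE.
- by rewrite subrr /frob /mxsq /mxip mulmx0 mxtrace0 sqrtr0 mul0r.
- by rewrite -opprB frobN.
- rewrite -mulrDl ler_wpM2r ?sqrtr_ge0 //.
  rewrite -(subrKA (unitary_mx b)); exact: frobD.
- by rewrite -mulmxBr /frob mxsq_mull // unitary_mxP.
- by rewrite -mulmxBl /frob mxsq_mulr // unitary_mxP.
Qed.

Lemma near_commutant n (H : finGroupType) (rho : H -> 'M[R[i]]_n) T (e : R) :
    (forall h, rho h \is unitarymx) ->
    (forall g h, rho (g * h)%g = rho g *m rho h) ->
    T \is unitarymx -> 0 < e ->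
  exists2 U, U \is unitarymx /\ (forall h, rho h *m U = U *m rho h) &
    frob (T - U) <= 2 * (\sum_h frob (rho h *m T - T *m rho h)) +
      e * frob (1%:M : 'M[R[i]]_n).
Proof.
move=> rhou rhoM Tu e_gt0.
(* An invertible idempotent is the identity. *)
have rho1 : rho 1%g = 1%:M.
  have u1 := unitarymx_unit (rhou 1%g).
  by rewrite -[LHS](mulmxK u1) -rhoM mulg1 mulmxV.
have rhoVM h : rho h^-1%g *m rho h = 1%:M by rewrite -rhoM mulVg.
have rhoMV h : rho h *m rho h^-1%g = 1%:M by rewrite -rhoM mulgV.
pose E := (#|H|%:R^-1)%:C%C *: \sum_h rho h *m T *m rho h^-1%g.
have rhoE h : rho h *m E = E *m rho h.
  rewrite -scalemxAl -scalemxAr; congr (_ *: _).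
  rewrite mulmx_sumr mulmx_suml [RHS](reindex_inj (mulgI h)) /=.
  apply: eq_bigr => g _.
  by rewrite rhoM invgM rhoM -!mulmxA rhoVM mulmx1.
have H_gt0 : 0 < #|H|%:R :> R by rewrite ltr0n (cardD1 1%g).
(* [E - T] averages the commutators multiplied by unitaries; the factor 1/|H| is then bounded by
   1. *)
have ETE : frob (E - T) <= \sum_h frob (rho h *m T - T *m rho h).
  have -> : E - T = (#|H|%:R^-1)%:C%C *: \sum_h (rho h *m T *m rho h^-1%g - T).
    rewrite sumrB sumr_const scalerBr -/E; congr (_ - _).
    rewrite -[T *+ _]scaler_nat scalerA.
    rewrite -[X in _ * X](rmorph_nat (real_complex R)) -rmorphM.
    by rewrite mulVf ?gt_eqF // scale1r.
  rewrite frobZ ?invr_ge0 ?ler0n //.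
  apply: le_trans (_ : frob (\sum_h (rho h *m T *m rho h^-1%g - T)) <= _).
    rewrite ler_piMl ?sqrtr_ge0 // invf_le1 // ler1n.
    by rewrite -(ltr0n R).
  apply: le_trans (frob_sum _) _; apply: ler_sum => h _.
  have -> : rho h *m T *m rho h^-1%g - T =
      (rho h *m T - T *m rho h) *m rho h^-1%g.
    by rewrite mulmxBl -(mulmxA T) rhoMV mulmx1.
  rewrite /frob mxsq_mulr; [exact: lexx | exact: rhou].
(* Infinitely many shifts with 2c at most e: one of them avoids the spectrum, and the 2 is the
   factor from the triangle inequality below. *)
pose c k : R := e / 2 / k.+1%:R.
have c_inj : injective (fun k => (c k)%:C%C).
  have e2_neq0 := lt0r_neq0 (divr_gt0 e_gt0 (ltr0Sn R 1)).
  move=> j k /complexI/(mulfI e2_neq0)/invr_inj/eqP.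
  by rewrite eqr_nat eqSS => /eqP.
have [k Au] := unitmx_perturb E c_inj.
have [U [P [s [Uu Pu s_gt0 AE UC]]]] := polar_decomposition Au.
have := polar_nearest Uu Pu s_gt0 AE Tu; set A := E + _ in Au AE UC * => AUT.
exists U; first split=> // h.
  apply: UC; first exact: rhou.
  rewrite mulmxDr mulmxDl rhoE.
  by rewrite scalar_mxC.
have c_ge0 : 0 <= c k by rewrite !divr_ge0 ?ler0n // ltW.
have ck : 2 * c k <= e.
  rewrite /c mulrA mulrCA mulfV ?pnatr_eq0 // mulr1.
  by rewrite ler_pdivrMr ?ltr0n // ler_peMr ?ler1n // ltW.
have AT : frob (A - T) <= frob (E - T) + c k * frob (1%:M : 'M[R[i]]_n).
  rewrite /A addrAC (le_trans (frobD _ _)) // lerD2l.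
  by rewrite -[X in frob X]scalemx1 frobZ.
(* As [U] is nearest to [A], both terms are at most [frob (A - T)]. *)
have -> : T - U = (A - U) - (A - T) by rewrite opprB [RHS]addrC subrKA.
apply: le_trans (frobD _ _) _; rewrite frobN.
apply: le_trans (lerD AUT (lexx _)) _.
rewrite -mulr2n -[leLHS]mulr_natl.
apply: (@le_trans _ _ (2 * (\sum_h frob (rho h *m T - T *m rho h) +
    c k * frob (1%:M : 'M[R[i]]_n)))).
  rewrite ler_pM2l ?ltr0n //; apply: le_trans AT _.
  by rewrite lerD2r; exact: ETE.
by rewrite mulrDr lerD2l mulrA ler_wpM2r ?sqrtr_ge0.
Qed.

Lemma frob1_le n : frob (1%:M : 'M[R[i]]_n) * Num.sqrt n%:R^-1 <= 1.
Proof.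
rewrite /frob unitary_sq_const; last exact: unitary1_subproof.
rewrite -sqrtrM ?ler0n // -[leRHS]sqrtr1; apply: ler_wsqrtr.
(* In dimension 0 the convention 0^-1 = 0 gives 0; otherwise the value is 1. *)
by case: n => [|n]; rewrite ?mul0r // mulfV ?pnatr_eq0.
Qed.

Lemma C_HS_correctable (H : finGroupType) : correctable (C_HS R) H.
Proof.
move=> n rho T e e_gt0 /=.
have rhoM g h : unitary_mx (rho (g * h)%g) = unitary_mx (rho g) *m unitary_mx (rho h).
  by rewrite gmulfM.
have [U [Uu UC] TU] := near_commutant (fun h => unitary_mxP (rho h)) rhoM
  (unitary_mxP T) e_gt0.
exists (Unitary Uu) => [h|]; first exact/val_inj/UC.
rewrite HS_distE /=; apply: le_trans (ler_wpM2r (sqrtr_ge0 _) TU) _.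
rewrite mulrDl -mulrA mulr_suml; apply: lerD.
  rewrite ler_wpM2l ?ler0n //; apply: ler_sum => h _.
  by rewrite HS_distE.
rewrite -mulrA; apply: ler_piMr; [exact: ltW | exact: frob1_le].
Qed.

End UnitaryClass.

Theorem theorem3 (R : realType) (C : metric_class R)
    (hC : C = C_HS R \/ C = C_P R)
    (H : finGroupType) (G : groupType) (i : {multiplicative H -> G}) :
  injective i -> finitely_generated G -> stable C G -> stable C (HNN i i).
Proof.
move=> _ _; case: hC => ->; apply: stable_HNN.
- exact: C_HS_biinvariant.
- exact: C_HS_correctable.
- exact: C_P_biinvariant.
- exact: C_P_correctable.
Qed.
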